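(* From any $7$ pairwise distinct points in $\mathbb{R}^4$ one can choose two disjoint triples such that the two triangles with vertices at the triples intersect.
   Context: The triangle with vertices at a triple of points is the (closed, two-dimensional) triangle spanned by them, i.e. the convex hull of the three points. The points are not assumed to be in general position, so a triangle may be degenerate. Two triangles intersect if they have at least one common point. *)

(* Defs.v *)
From mathcomp Require Import all_boot all_order all_algebra.
From mathcomp Require Import classical_sets reals convex.
Set Implicit Arguments.
Unset Strict Implicit.
Unset Printing Implicit Defensive.
Local Open Scope classical_set_scope.
Local Open Scope ring_scope.

Definition convex_hull (R : numDomainType) (E : lmodType R) (A : set E) :
  set E := smallest (@convex_set R E) A.

Definition triangle (R : numDomainType) (E : lmodType R) (a b c : E) : set E :=
  convex_hull [set a; b; c].

(* Main.v *)
Require Import Defs.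
From mathcomp Require Import all_boot all_order all_algebra.
From mathcomp Require Import classical_sets reals convex.
From mathcomp Require Import boolp filter topology normedtype interval_inference.
From mathcomp Require Import zify lra.
Set Implicit Arguments.
Unset Strict Implicit.
Unset Printing Implicit Defensive.
Import Order.TTheory GRing.Theory Num.Theory.
Import numFieldNormedType.Exports.
Local Open Scope classical_set_scope.
Local Open Scope ring_scope.

(** This is the linear van Kampen-Flores theorem in dimension 4. As in the proof
    of Radon's theorem, an affine dependence [sum_i v_i = 0],
    [sum_i v_i p_i = 0] with [v <> 0] yields a point common to the convex hulls
    of the points with positive coefficient and of those with negative
    coefficient ([radon_point]). So it suffices to find a dependence with at
    most three coefficients of each sign: the two supports then extend to
    disjoint triples ([enclosing_disjoint_triples]).

    Seven points in R^4 satisfy only five linear conditions on dependences, so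
    the dependences form a space of dimension at least two
    ([exists_affine_dependences]), one more than Radon's theorem uses. The extra
    dimension gives room for a ham-sandwich argument
    ([exists_balanced_vector]). If no dependence were balanced, each nonzero one
    would have a strict majority of its seven coefficients of one sign, and the
    majority sign would be reversed by [v |-> - v]. Hence there would be two
    linearly independent dependences with majorities of opposite sign. On the
    segment joining them, which avoids 0, positive majority and negative
    majority are disjoint open conditions, each holding at one end; as a segment
    is connected, some point of it satisfies neither. *)

Definition positive_support (R : numDomainType) (n : nat) (v : 'rV[R]_n) : {set 'I_n} :=
  [set i | 0 < v 0 i].

(** Stating this as membership in the cone over [A], with no condition on the
    total weight, lets the induction on the sum pass through partial sums of
    weight zero, which cannot be normalised. *)
Lemma weighted_sum_in_convex (R : realFieldType) (E : lmodType R) (A : set E)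
    (I : finType) (P : pred I) (w : I -> R) (p : I -> E) :
  convex_set A -> A !=set0 ->
  (forall i, P i -> 0 <= w i) -> (forall i, P i -> A (p i)) ->
  exists2 c, A c & \sum_(i | P i) w i *: p i = (\sum_(i | P i) w i) *: c.
Proof.
move=> convA [a Aa] w_ge0 Ap.
pose in_cone (v : E) (W : R) := 0 <= W /\ exists2 c, A c & v = W *: c.
suff [] : in_cone (\sum_(i | P i) w i *: p i) (\sum_(i | P i) w i) by [].
apply: (big_ind2 in_cone).
- by split => //; exists a; rewrite ?scale0r.
- move=> _ W1 _ W2 [W1_ge0 [c1 Ac1 ->]] [W2_ge0 [c2 Ac2 ->]].
  split; first exact: addr_ge0.
  have [W0|W_neq0] := eqVneq (W1 + W2) 0.
    have [-> ->] : W1 = 0 /\ W2 = 0 by split; lra.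
    by exists a; rewrite ?addr0 ?scale0r ?addr0.
  have W_gt0 : 0 < W1 + W2 by rewrite lt_def W_neq0 addr_ge0.
  have t_ge0 : 0 <= W1 / (W1 + W2) by rewrite divr_ge0 // ltW.
  have t_le1 : W1 / (W1 + W2) <= 1 by rewrite ler_pdivrMr // mul1r lerDl.
  exists (conv (Itv01 t_ge0 t_le1) (c1 : convex_lmodType E) c2).
    by apply/set_mem/convA; apply/mem_set.
  rewrite [RHS](_ : _ = (W1 + W2) *: (W1 / (W1 + W2) *: c1 +
    (1 - W1 / (W1 + W2)) *: c2)) //.
  rewrite scalerDr !scalerA mulrBr mulr1 mulrC divfK //.
  by rewrite addrAC subrr add0r.
- by move=> i Pi; split; [exact: w_ge0 | exists (p i) => //; exact: Ap].
Qed.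

Lemma barycenter_in_convex_hull (R : realFieldType) (E : lmodType R)
    (A : set E) (I : finType) (P : pred I) (w : I -> R) (p : I -> E) :
  (forall i, P i -> 0 <= w i) -> (forall i, P i -> A (p i)) ->
  0 < \sum_(i | P i) w i ->
  convex_hull A ((\sum_(i | P i) w i)^-1 *: \sum_(i | P i) w i *: p i).
Proof.
move=> w_ge0 Ap W_gt0 M [convM subAM].
have [i Pi | P0] := pickP P; last by rewrite big_pred0 ?ltxx in W_gt0.
have M_neq0 : M !=set0 by exists (p i); apply: subAM; exact: Ap.
have [j Pj|c Mc ->] := weighted_sum_in_convex (p := p) convM M_neq0 w_ge0.
  by apply: subAM; exact: Ap.
by rewrite scalerA mulVf ?scale1r // gt_eqF.
Qed.

(** Positivity of a coordinate is an open condition, so the positive support can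
    only grow under a small perturbation. *)
Lemma open_many_positive (R : realType) (n k : nat) (u v : 'rV[R]_n) :
  open [set s : R | (k <= #|positive_support (u + s *: v)|)%N].
Proof.
rewrite openE => s /= le_k.
have : \forall t \near s, forall i, i \in positive_support (u + s *: v) ->
    0 < (u + t *: v) 0 i.
  apply: (@filter_forall R 'I_n (fun i t => i \in positive_support (u + s *: v) ->
    0 < (u + t *: v) 0 i) (nbhs s) _ _) => i.
  rewrite inE.
  have [pos_i|_] := boolP (0 < _); last exact: nearW.
  have : (fun t : R => (u + t *: v) 0 i) @ s --> (u + s *: v) 0 i.
    rewrite !mxE; under eq_fun do rewrite !mxE.
    by apply: cvgD; [exact: cvg_cst | apply: cvgM; [exact: cvg_id | exact: cvg_cst]].
  by move=> /cvgr_gt /(_ _ pos_i); apply: filterS.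
apply: filterS => t pos_t /=; apply: leq_trans le_k _.
by apply/subset_leq_card/fintype.subsetP => i /pos_t; rewrite inE.
Qed.

(** Connectedness of [[0, 1]]: if [U] and [V] covered the line, the trace of [U]
    on the segment would be clopen. *)
Lemma segment_not_covered (R : realType) (U V : set R) :
  open U -> open V -> U `&` V = set0 -> U 0 -> V 1 ->
  exists s, ~ U s /\ ~ V s.
Proof.
move=> openU openV UV0 U0 V1; apply: contrapT => cover.
have UVE : U = ~` V.
  apply/seteqP; split=> s; first by move=> Us Vs; have : (U `&` V) s by []; rewrite UV0.
  by move=> nVs; apply: contrapT => nUs; apply: cover; exists s.
have all_in_U : `[0, 1]%classic `&` U = `[0, 1]%classic.
  apply: segment_connected.
  - by exists 0; split => //=; rewrite in_itv /= lexx ler01.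
  - by exists U.
  - by exists U => //; rewrite UVE; exact: open_closedC.
have : (`[0, 1]%classic `&` U) 1 by rewrite all_in_U /= in_itv /= lexx ler01.
by rewrite UVE => -[].
Qed.

Lemma positive_support_disjoint (R : realDomainType) (n : nat) (v : 'rV[R]_n) :
  [disjoint positive_support v & positive_support (- v)]%B.
Proof.
rewrite finset.disjoints_subset; apply/fintype.subsetP => i.
by rewrite !inE mxE oppr_gt0 -leNgt => /ltW.
Qed.

(** A space of dimension at least two contains a nonzero vector without a strict
    majority of coordinates of either sign; two dimensions are what makes it
    possible to go from [u] to a negative-majority vector without passing
    through 0. The bound [k.*2.+1] makes strict majorities of the two signs
    mutually exclusive. *)
Lemma exists_balanced_vector (R : realType) (m n k : nat) (K : 'M[R]_(m, n)) :
  (n <= k.*2.+1)%N -> (1 < \rank K)%N ->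
  exists v : 'rV[R]_n, [/\ v != 0, (v <= K)%MS,
    (#|positive_support v| <= k)%N & (#|positive_support (- v)| <= k)%N].
Proof.
move=> le_n rankK.
have card_le (v : 'rV[R]_n) : (k < #|positive_support v|)%N ->
    (#|positive_support (- v)| <= k)%N.
  move=> lt_k; rewrite leqNgt; apply/negP => lt_k'.
  have disj := positive_support_disjoint v.
  have := max_card (mem (positive_support v :|: positive_support (- v))).
  rewrite (eqP (etrans (leq_card_setU _ _).2 disj)) card_ord.
  by move=> /(leq_trans (leq_add lt_k lt_k')); lia.
apply: contrapT => no_balanced.
have majority (v : 'rV[R]_n) : v != 0 -> (v <= K)%MS ->
    (k < #|positive_support v|)%N \/ (k < #|positive_support (- v)|)%N.
  move=> v0 vK; have [lt_k|ge_k] := ltnP k #|positive_support v|; first by left.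
  by right; rewrite ltnNge; apply/negP => ge_k'; apply: no_balanced; exists v.
(* Changing the sign of a vector of the space, if necessary, makes its majority
   positive (for [u]) or negative (for [w]). *)
have [u [u0 uK posu]] : exists u, [/\ u != 0, (u <= K)%MS &
    (k < #|positive_support u|)%N].
  have K0 : K != 0 by rewrite -mxrank_eq0 -lt0n ltnW.
  have r0 : nz_row K != 0 by rewrite nz_row_eq0.
  have [|] := majority _ r0 (nz_row_sub K); first by exists (nz_row K); rewrite nz_row_sub.
  by exists (- nz_row K); rewrite oppr_eq0 eqmx_opp nz_row_sub.
have /row_subPn[i0 nsub0] : ~~ (K <= u)%MS.
  apply/negP => /mxrankS /(leq_trans rankK).
  by rewrite rank_rV u0.
have [w [wK wu negw]] : exists w, [/\ (w <= K)%MS, ~~ (w <= u)%MS &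
    (k < #|positive_support (- w)|)%N].
  have r0 : row i0 K != 0 by apply: contraNneq nsub0 => ->; exact: sub0mx.
  have [pos|neg] := majority _ r0 (row_sub i0 K).
    by exists (- row i0 K); rewrite !eqmx_opp row_sub opprK.
  by exists (row i0 K); rewrite row_sub.
(* The segment from [u] to [w] misses 0 because [w] is not a multiple of [u]. *)
pose x s := u + s *: (w - u).
have xK s : (x s <= K)%MS by rewrite addmx_sub // scalemx_sub // addmx_sub // eqmx_opp.
have x0 s : x s != 0.
  apply/eqP => xs0; have [s0|s_neq0] := eqVneq s 0.
    by move: u0; rewrite -xs0 /x s0 scale0r addr0 eqxx.
  have sw : s *: w = (s - 1) *: u.
    by move: xs0; rewrite /x scalerBr scalerBl scale1r addrCA => /eqP;
      rewrite addr_eq0 => /eqP ->; rewrite opprB.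
  case/negP: wu; rewrite -(eqmx_scale _ s_neq0) sw; exact: scalemx_sub.
have [| | | | |s [nU nV]] := @segment_not_covered R
   [set s | (k < #|positive_support (u + s *: (w - u))|)%N]
   [set s | (k < #|positive_support (- u + s *: (u - w))|)%N].
- exact: open_many_positive.
- exact: open_many_positive.
- apply/seteqP; split => // s [/= /card_le].
  by rewrite opprD -scalerN opprB ltnNge => ->.
- by rewrite /= scale0r addr0.
- by rewrite /= scale1r addrA addNr add0r.
have [//|] := majority _ (x0 s) (xK s).
by rewrite /x opprD -scalerN opprB.
Qed.

(** The dependences are the left kernel of the matrix whose [i]-th row is [p i]
    preceded by a 1; it has [d.+1] columns, whence the bound on the rank. *)
Lemma exists_affine_dependences (R : fieldType) (n d : nat) (p : 'I_n -> 'rV[R]_d) :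
  exists K : 'M[R]_n, (n - d.+1 <= \rank K)%N /\
   forall v : 'rV_n, (v <= K)%MS ->
     \sum_i v 0 i = 0 /\ \sum_i v 0 i *: p i = 0.
Proof.
pose A := row_mx (const_mx 1 : 'cV[R]_n) (\matrix_i p i).
exists (kermx A); split.
  by rewrite mxrank_ker leq_sub2l // rank_leq_col.
move=> v /sub_kermxP; rewrite mul_mx_row => vA0.
have [v1 vp] := eq_row_mx (etrans vA0 (esym (row_mx0 _ _ _ _))).
split.
  have := congr1 (fun M : 'M_1 => M 0 0) v1.
  by rewrite !mxE; under eq_bigr do rewrite mxE mulr1.
by rewrite -[RHS]vp mulmx_sum_row; under [RHS]eq_bigr do rewrite rowK.
Qed.

(** Moving the negative terms to the other side turns the dependence into an
    equality of two positive combinations of the same total weight [W]; dividing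
    by [W] exhibits a common point. *)
Lemma radon_point (R : realFieldType) (E : lmodType R) (n : nat)
    (p : 'I_n -> E) (v : 'rV[R]_n) (A B : set E) :
  v != 0 -> \sum_i v 0 i = 0 -> \sum_i v 0 i *: p i = 0 ->
  (forall i, i \in positive_support v -> A (p i)) ->
  (forall i, i \in positive_support (- v) -> B (p i)) ->
  convex_hull A `&` convex_hull B !=set0.
Proof.
move=> v0 sum0 comb0 Ap Bp.
pose W := \sum_(i in positive_support v) v 0 i.
pose S := \sum_(i in positive_support v) v 0 i *: p i.
have split_sum (V : lmodType R) (f : 'I_n -> V) : \sum_i v 0 i *: f i = 0 ->
    \sum_(i in positive_support (- v)) (- v) 0 i *: f i =
    \sum_(i in positive_support v) v 0 i *: f i.
  rewrite (bigID (mem (positive_support v))) /= => /eqP.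
  rewrite addr_eq0 => /eqP ->; rewrite -sumrN big_mkcond [RHS]big_mkcond /=.
  apply: eq_bigr => i _; rewrite !inE !mxE oppr_gt0 -scaleNr.
  by case: ltgtP => // ->; rewrite oppr0 scale0r.
(* [split_sum] also applies to the scalar sums, read in the module [R^o]. *)
have scale1 (P : pred 'I_n) (f : 'I_n -> R) :
    \sum_(i | P i) f i = \sum_(i | P i) f i *: (1 : R^o).
  by apply: eq_bigr => i _; rewrite /GRing.scale /= mulr1.
have W_neg : \sum_(i in positive_support (- v)) (- v) 0 i = W.
  by rewrite scale1 split_sum -?scale1.
have S_neg : \sum_(i in positive_support (- v)) (- v) 0 i *: p i = S.
  exact: split_sum.
(* If [W] were 0, no coefficient of [v] could be positive, nor, by [W_neg],
   negative. *)
have W_gt0 : 0 < W.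
  rewrite lt_def sumr_ge0 ?andbT; last by move=> i; rewrite inE => /ltW.
  apply: contra_neq v0 => W0.
  have le0 (u : 'rV[R]_n) : \sum_(i in positive_support u) u 0 i = 0 ->
      forall i, u 0 i <= 0.
    move=> u0 i; rewrite leNgt; apply/negP => ui.
    have /eqP := u0; rewrite psumr_eq0; last by move=> j; rewrite inE => /ltW.
    by move=> /allP /(_ i (mem_index_enum i)); rewrite inE ui gt_eqF.
  apply/rowP => i; rewrite mxE; apply/eqP; rewrite eq_le le0 //=.
  by have := le0 _ (etrans W_neg W0) i; rewrite mxE oppr_le0.
exists (W^-1 *: S); split.
  by apply: barycenter_in_convex_hull => // i; rewrite inE => /ltW.
rewrite -W_neg -S_neg; apply: barycenter_in_convex_hull => //; last by rewrite W_neg.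
by move=> i; rewrite inE => /ltW.
Qed.

(** Listing [P] first, [N] last and the remaining indices in between, the first
    three and the last three entries are the required triples. *)
Lemma enclosing_disjoint_triples (P N : {set 'I_7}) :
  [disjoint P & N]%B -> (#|P| <= 3)%N -> (#|N| <= 3)%N ->
  exists i j k l m n : 'I_7, [/\ uniq [:: i; j; k; l; m; n],
    {subset P <= [:: i; j; k]} & {subset N <= [:: l; m; n]}].
Proof.
move=> disjPN leP leN.
pose s := enum P ++ enum (~: (P :|: N)) ++ enum N.
have sizes : size s = 7.
  rewrite !size_cat -!cardE addnCA -(eqP (etrans (leq_card_setU P N).2 disjPN)).
  by rewrite addnC cardsC card_ord.
have uniqs : uniq s.
  apply: (leq_size_uniq (enum_uniq 'I_7)); last by rewrite sizes size_enum_ord.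
  move=> x _; rewrite !mem_cat !mem_enum !inE.
  by case: (x \in P); case: (x \in N).
have subP : {subset P <= take 3 s}.
  by move=> x xP; rewrite take_cat -cardE; case: ltngtP leP => // _ _;
    rewrite ?mem_cat mem_enum xP.
have subN : {subset N <= drop 4 s}.
  move=> x xN.
  have : x \in drop (7 - #|N|) s.
    have size7 : 7 = (size (enum P ++ enum (~: (P :|: N))) + #|N|)%N.
      by rewrite -sizes /s catA size_cat -[X in (_ + X)%N]cardE.
    by rewrite [X in (X - _)%N]size7 addnK /s catA drop_size_cat // mem_enum.
  rewrite -[(7 - #|N|)%N](@subnK 4) ?leq_subRL // -?drop_drop; last by lia.
    exact: mem_drop.
  by rewrite addnC; move: leN; rewrite -(leq_add2l 4).
(* The middle entry [z] of the list is discarded. *)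
clearbody s.
case: s sizes uniqs subP subN => [|i [|j [|k [|z [|l [|m [|n []]]]]]]] //= _.
move=> uniqs subP subN; exists i, j, k, l, m, n; split => //.
exact: (subseq_uniq (s1 := [:: i; j; k] ++ [:: l; m; n])
  (cat_subseq (subseq_refl [:: i; j; k]) (subseq_cons [:: l; m; n] z)) uniqs).
Qed.

Theorem theorem1p3 (R : realType) (p : 'I_7 -> 'rV[R]_4)
    (p_inj : injective p) :
  exists i j k l m n : 'I_7,
    uniq [:: i; j; k; l; m; n] /\
    triangle (p i) (p j) (p k) `&` triangle (p l) (p m) (p n) !=set0.
Proof.
have [K [rankK affK]] := exists_affine_dependences p.
have [v [v0 vK leP leN]] := exists_balanced_vector (n := 7) (k := 3) isT rankK.
have [sum0 comb0] := affK v vK.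
have [i [j [k [l [m [n [uniq_s subP subN]]]]]]] :=
  enclosing_disjoint_triples (positive_support_disjoint v) leP leN.
exists i, j, k, l, m, n; split => //.
apply: (radon_point v0 sum0 comb0) => // x.
  by move=> /subP; rewrite !inE => /or3P[] /eqP ->; rewrite /setU /=; tauto.
by move=> /subN; rewrite !inE => /or3P[] /eqP ->; rewrite /setU /=; tauto.
Qed.
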